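(* Let $K_n$ be the number of distinct ordered clade shapes occurring in $\mathrm{DTCS}(n)$ and let $K_n^u$ be the number of distinct unordered clade shapes occurring in $\mathrm{DTCS}(n)$. Then $K_n$ and $K_n^u$ are both $$\Theta\left(\frac{n\log\log n}{\log n}\right)$$ with high probability as $n\to\infty$.
   Context: Binary trees are rooted full binary trees: every internal vertex has exactly two children. Ordered trees (plane trees) are trees in which the left and right subtrees of each internal vertex are distinguished; $T=T'$ means identical as rooted ordered trees, and $T\cong T'$ means identical as rooted unordered trees. For $m\ge 2$ let $h_{m-1}=\sum_{j=1}^{m-1}1/j$ and let $q_m$ be the probability distribution on $\{1,\dots,m-1\}$ given by $$q_m(i)=\frac{m}{2h_{m-1}}\,\frac{1}{i(m-i)}.$$ The discrete-time critical beta-splitting tree $\mathrm{DTCS}(n)$ is the random rooted ordered binary tree with $n$ leaves built as follows: split $[n]=\{1,\dots,n\}$ into a left subtree on $\{1,\dots,L_n\}$ and a right subtree on $\{L_n+1,\dots,n\}$, where $L_n$ has distribution $q_n$; then recursively and independently split each interval of size $m\ge2$ into left and right parts according to $q_m$, stopping at intervals of size $m=1$ (the leaves). Leaf labels are disregarded when comparing shapes. A clade (fringe subtree) of a rooted tree is the subtree induced by an internal vertex together with all of its descendants. For a rooted binary tree shape $\chi$, $N_n(\chi)$ is the number of clades of $\mathrm{DTCS}(n)$ whose shape is $\chi$ (compared as ordered trees if $\chi$ is ordered, as unordered trees if $\chi$ is unordered). Then $$K_n=\sum_{\chi\text{ ordered}}\mathbf 1_{[N_n(\chi)\ge1]},\qquad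 K_n^u=\sum_{\chi\text{ unordered}}\mathbf 1_{[N_n(\chi)\ge1]}.$$ $\log$ is the natural logarithm. ''$X_n=\Theta(f(n))$ with high probability'' means that there are constants $0<c<C<\infty$ such that $\mathbb{P}(cf(n)\le X_n\le Cf(n))\to1$ as $n\to\infty$. *)

(* Defs.v *)
From HB Require Import structures.
From mathcomp Require Import all_boot all_order all_algebra.
From mathcomp Require Import generic_quotient.
From mathcomp Require Import ring.
From mathcomp Require Import all_classical all_reals all_analysis.
From mathcomp Require Import measurable_realfun giry.

Set Implicit Arguments.
Unset Strict Implicit.
Unset Printing Implicit Defensive.

Import Order.TTheory GRing.Theory Num.Theory.
Import numFieldNormedType.Exports.

Local Open Scope classical_set_scope.
Local Open Scope quotient_scope.
Local Open Scope ring_scope.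

Inductive btree : Type := Leaf | Node of btree & btree.

Fixpoint btree_encode (t : btree) : GenTree.tree unit :=
  match t with
  | Leaf => GenTree.Node 0 [::]
  | Node l r => GenTree.Node 1 [:: btree_encode l; btree_encode r]
  end.

Fixpoint btree_decode (g : GenTree.tree unit) : btree :=
  match g with
  | GenTree.Node 1 [:: l; r] => Node (btree_decode l) (btree_decode r)
  | _ => Leaf
  end.

Lemma btree_encodeK : cancel btree_encode btree_decode.
Proof. by elim=> //= l -> r ->. Qed.

HB.instance Definition _ := Countable.copy btree (can_type btree_encodeK).
HB.instance Definition _ := isPointed.Build btree Leaf.
HB.instance Definition _ := @isMeasurable.Build default_measure_display
  btree discrete_measurable discrete_measurable0
  discrete_measurableC discrete_measurableU.

(* Equality as rooted unordered trees: the two children of any internal vertex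
   may be swapped. *)
Fixpoint uiso (s t : btree) : bool :=
  match s, t with
  | Leaf, Leaf => true
  | Node l r, Node l' r' =>
      (uiso l l' && uiso r r') || (uiso l r' && uiso r l')
  | _, _ => false
  end.

Lemma uiso_refl : reflexive uiso.
Proof. by elim=> //= l -> r ->. Qed.

Lemma uiso_sym : symmetric uiso.
Proof.
by elim=> [|l IHl r IHr] [|l' r'] //=; rewrite !IHl !IHr [uiso r' l && _]andbC.
Qed.

Lemma uiso_trans : transitive uiso.
Proof.
move=> y x z; elim: y x z => [|l IHl r IHr] [|l1 r1] [|l2 r2] //=.
case/orP=> /andP[h1 h2] /orP[] /andP[h3 h4]; apply/orP.
- by left; rewrite (IHl _ _ h1 h3) (IHr _ _ h2 h4).
- by right; rewrite (IHl _ _ h1 h3) (IHr _ _ h2 h4).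
- by right; rewrite (IHr _ _ h1 h4) (IHl _ _ h2 h3).
- by left; rewrite (IHr _ _ h1 h4) (IHl _ _ h2 h3).
Qed.

Canonical uiso_equiv := EquivRel uiso uiso_refl uiso_sym uiso_trans.

Definition utree := {eq_quot uiso_equiv}.
HB.instance Definition _ := Choice.on utree.

Definition shape_u (t : btree) : utree := \pi_utree t.

Lemma shape_uP (s t : btree) : reflect (shape_u s = shape_u t) (uiso s t).
Proof. by apply: (iffP idP) => [st|/eqmodP //]; apply/eqmodP. Qed.

(* One clade per internal vertex, with multiplicity: a leaf is not a clade. *)
Fixpoint clades (t : btree) : seq btree :=
  match t with
  | Leaf => [::]
  | Node l r => t :: clades l ++ clades r
  end.

Definition clade_count (chi : btree) (t : btree) : nat :=
  count (fun s => s == chi) (clades t).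

Definition clade_count_u (chi : utree) (t : btree) : nat :=
  count (fun s => shape_u s == chi) (clades t).

Definition num_clade_shapes (t : btree) : nat :=
  \big[addn/0%N]_(chi \in [set: btree]) (1 <= clade_count chi t)%N.

Definition num_clade_shapes_u (t : btree) : nat :=
  \big[addn/0%N]_(chi \in [set: utree]) (1 <= clade_count_u chi t)%N.

(* The two sums above have finite support, and so are not the default value. *)
Lemma fsbig_count_ge1 (T : choiceType) (s : seq T) :
  \big[addn/0%N]_(x \in [set: T]) (1 <= count_mem x s)%N = size (undup s).
Proof.
have cntE x : (1 <= count_mem x s)%N = (x \in undup s).
  by rewrite mem_undup -has_pred1 has_count.
under eq_fsbigr do rewrite cntE.
rewrite (fsbigE (undup s)) ?undup_uniq//; last by move=> x _ /negbTE ->.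
rewrite -sum1_size big_mkcond/=; apply: eq_big_seq => x ->.
by rewrite in_setT.
Qed.

Lemma num_clade_shapesE t : num_clade_shapes t = size (undup (clades t)).
Proof. exact: fsbig_count_ge1. Qed.

Lemma num_clade_shapes_uE t :
  num_clade_shapes_u t = size (undup (map shape_u (clades t))).
Proof.
rewrite -fsbig_count_ge1; apply: eq_fsbigr => chi _.
by rewrite count_map.
Qed.

Section critical_split.
Context {R : realType}.
Implicit Types m i : nat.

Definition harmonic_sum (k : nat) : R := \sum_(1 <= j < k.+1) j%:R^-1.

Definition split_pmf m i : R :=
  if (0 < i < m)%N
  then m%:R / (2 * harmonic_sum m.-1) * (i%:R * (m - i)%:R)^-1
  else 0.

Lemma harmonic_sum_ge0 k : 0 <= harmonic_sum k.
Proof. by apply: sumr_ge0 => j _; rewrite invr_ge0. Qed.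

Lemma harmonic_sum_gt0 k : (0 < k)%N -> 0 < harmonic_sum k.
Proof.
case: k => // k _; rewrite /harmonic_sum big_ltn// invr1.
by rewrite ltr_pwDl// sumr_ge0// => j _; rewrite invr_ge0.
Qed.

Lemma split_pmf_ge0 m i : 0 <= split_pmf m i.
Proof.
rewrite /split_pmf; case: ifP => // _.
by rewrite !mulr_ge0 ?invr_ge0 ?mulr_ge0 ?harmonic_sum_ge0.
Qed.

Lemma sum_split_pmf m : (1 < m)%N -> \sum_(1 <= i < m) split_pmf m i = 1.
Proof.
move=> m1; have m0 : (0 < m)%N by exact: ltn_trans m1.
have h0 : 0 < harmonic_sum m.-1.
  by apply: harmonic_sum_gt0; rewrite -ltnS prednK.
have hE : \sum_(1 <= i < m) i%:R^-1 = harmonic_sum m.-1 :> R.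
  by rewrite /harmonic_sum prednK.
transitivity (\sum_(1 <= i < m)
    ((2 * harmonic_sum m.-1)^-1 * (i%:R^-1 + (m - i)%:R^-1))).
  apply: eq_big_nat => i /andP[i0 im]; rewrite /split_pmf i0 im/=.
  have i0R : i%:R != 0 :> R by rewrite pnatr_eq0 -lt0n.
  have mi0R : (m - i)%:R != 0 :> R by rewrite pnatr_eq0 subn_eq0 -ltnNge.
  have -> : m%:R = i%:R + (m - i)%:R :> R by rewrite -natrD subnKC// ltnW.
  by field; rewrite i0R mi0R gt_eqF.
rewrite -mulr_sumr big_split/= hE.
have -> : \sum_(1 <= i < m) (m - i)%:R^-1 = harmonic_sum m.-1 :> R.
  rewrite -hE [RHS]big_nat_rev/=; apply: eq_big_nat => i _.
  by rewrite add1n subSS.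
by field; rewrite gt_eqF.
Qed.

(* The distribution q_m; for m < 2 it is the junk value \d_0. *)
Definition split_prob m : set nat -> \bar R := fun U =>
  if (1 < m)%N then (\esum_(i in U) (split_pmf m i)%:E)%E else (\d_0%N U).

Section split_prob_measure.
Local Open Scope ereal_scope.
Variable m : nat.

Let split_prob0 : split_prob m set0 = 0.
Proof. by rewrite /split_prob measure0; case: ifPn => //; rewrite esum_set0. Qed.

Let split_prob_ge0 U : 0 <= split_prob m U.
Proof.
rewrite /split_prob; case: ifPn => // _; apply: esum_ge0 => i _.
by rewrite lee_fin split_pmf_ge0.
Qed.

Let split_prob_sigma_additive : semi_sigma_additive (split_prob m).
Proof.
move=> F mF tF mUF; rewrite /split_prob; case: ifPn => m1; last first.
  exact: measure_semi_sigma_additive.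
apply: cvg_toP.
  apply: ereal_nondecreasing_is_cvgn => a b ab.
  apply: lee_sum_nneg_natr => // k _ _.
  by apply: esum_ge0 => i _; rewrite lee_fin split_pmf_ge0.
by rewrite nneseries_sum_bigcup// => i; rewrite lee_fin split_pmf_ge0.
Qed.

HB.instance Definition _ := isMeasure.Build _ _ _ (split_prob m)
  split_prob0 split_prob_ge0 split_prob_sigma_additive.

Lemma split_probE (U : set nat) : (1 < m)%N ->
  split_prob m U = \sum_(1 <= i < m) (split_pmf m i)%:E * \d_i U.
Proof.
move=> m1; rewrite /split_prob m1.
have pmf0 i : 0 <= (split_pmf m i)%:E by rewrite lee_fin split_pmf_ge0.
rewrite (esumID [set` index_iota 1 m])// [X in _ + X]esum1 ?adde0; last first.
  by move=> i [_ /negP]; rewrite /= mem_index_iota /split_pmf => /negbTE ->.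
rewrite setIC esum_mkcondr esum_fset; [|exact: finite_seq|]; last first.
  by move=> i _; case: ifPn.
rewrite -fsbig_seq ?iota_uniq//=; apply: eq_bigr => i _.
by rewrite diracE; case: (i \in U); rewrite ?mule1 ?mule0.
Qed.

Let split_prob_setT : split_prob m [set: nat] = 1.
Proof.
have [m1|m1] := ltnP 1 m; last by rewrite /split_prob ltnNge m1 diracT.
rewrite split_probE//; under eq_bigr do rewrite diracT mule1.
by rewrite sumEFin sum_split_pmf.
Qed.

HB.instance Definition _ :=
  Measure_isProbability.Build _ _ R (split_prob m) split_prob_setT.

End split_prob_measure.
End critical_split.

Lemma measurable_fun_nat d (T : measurableType d) (f : nat -> T) :
  measurable_fun [set: nat] f.
Proof. by []. Qed.

Lemma measurable_fun_btree d (T : measurableType d) (f : btree -> T) :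
  measurable_fun [set: btree] f.
Proof. by []. Qed.

Section dtcs.
Context {R : realType}.
Local Open Scope ereal_scope.

(* k bounds the depth of the recursion; its value is irrelevant once k >= m
   (dtcs_rec_fuel). For m = 0, which does not occur, the tree is a leaf. *)
Fixpoint dtcs_rec (k m : nat) : giry btree R :=
  if k is k'.+1 then
    if (m <= 1)%N then giry_ret Leaf
    else giry_bind (split_prob m : giry nat R)
      (measurable_fun_nat (fun i : nat => giry_bind (dtcs_rec k' i)
        (measurable_fun_btree (fun l : btree => giry_bind (dtcs_rec k' (m - i))
          (measurable_fun_btree (fun r : btree => giry_ret (Node l r)))))))
  else giry_ret Leaf.

Lemma giry_bindE d1 d2 (T1 : measurableType d1) (T2 : measurableType d2)
    (mu : giry T1 R) (f : T1 -> giry T2 R) (mf : measurable_fun [set: T1] f)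
    (A : set T2) :
  measurable A -> giry_bind mu mf A = \int[mu]_x f x A.
Proof.
move=> mA; rewrite /giry_bind/= -/(giry_ev _ _) giry_int_map//.
exact: measurable_giry_ev.
Qed.

Lemma integral_split_prob m (f : nat -> \bar R) : (1 < m)%N ->
  (forall i, 0 <= f i) ->
  \int[split_prob m]_i f i = \sum_(1 <= i < m) (split_pmf m i)%:E * f i.
Proof.
move=> m1 f0.
rewrite (eq_measure_integral (msum (fun i =>
  mscale (NngNum (split_pmf_ge0 m i.+1))
    (\d_(i.+1) : {measure set nat -> \bar R})) m.-1)); last first.
  move=> A _ _; rewrite [LHS](split_probE A m1) /msum big_add1 big_mkord/=.
  by apply: eq_bigr => i _.
have mf : measurable_fun [set: nat] f by [].
rewrite (ge0_integral_measure_sum _ measurableT (fun x _ => f0 x) mf).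
rewrite big_add1 big_mkord; apply: eq_bigr => i _.
by rewrite ge0_integral_mscale// integral_dirac//= diracT mul1e.
Qed.

Lemma dtcs_recS k m (A : set btree) : (1 < m)%N ->
  dtcs_rec k.+1 m A = \sum_(1 <= i < m) (split_pmf m i)%:E *
    \int[dtcs_rec k i]_l \int[dtcs_rec k (m - i)]_r \d_(Node l r) A.
Proof.
move=> m1; rewrite [dtcs_rec _ _]/= ifN -?ltnNge// giry_bindE//.
rewrite integral_split_prob//; apply: eq_bigr => i _; congr (_ * _).
rewrite giry_bindE//; apply: eq_integral => l _.
by rewrite giry_bindE.
Qed.

Lemma dtcs_rec_fuel k k' m (A : set btree) : (m <= k)%N -> (m <= k')%N ->
  dtcs_rec k m A = dtcs_rec k' m A.
Proof.
elim: k k' m A => [|k IH] [|k'] m A //.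
- by rewrite leqn0 => /eqP ->.
- by move=> _; rewrite leqn0 => /eqP ->.
move=> mk mk'; have [m1|m1] := leqP m 1; first by rewrite /= m1.
rewrite !dtcs_recS//; apply: eq_big_nat => i /andP[i0 im]; congr (_ * _).
have ik : (i <= k)%N by rewrite -ltnS (leq_trans im).
have ik' : (i <= k')%N by rewrite -ltnS (leq_trans im).
have jm : (m - i < m)%N by rewrite ltn_subrL i0 (ltn_trans _ m1).
have jk : (m - i <= k)%N by rewrite -ltnS (leq_trans jm).
have jk' : (m - i <= k')%N by rewrite -ltnS (leq_trans jm).
rewrite (eq_measure_integral (dtcs_rec k' i)); last by move=> B _ _; exact: IH.
apply: eq_integral => l _.
by apply: eq_measure_integral => B _ _; exact: IH.
Qed.

Lemma dtcs_rec_setT k m : dtcs_rec k m [set: btree] = 1.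
Proof.
elim: k m => [|k IH] m /=; first exact: diracT.
case: ifPn => [_|]; first exact: diracT.
rewrite -ltnNge => m1; rewrite giry_bindE//.
rewrite -[RHS](@probability_setT _ _ _ (split_prob m)).
rewrite -[RHS]mul1e -integral_cst//; apply: eq_integral => i _.
rewrite giry_bindE// -(IH i) -[RHS]mul1e -integral_cst//.
apply: eq_integral => l _.
rewrite giry_bindE// -(IH (m - i)%N) -[RHS]mul1e -integral_cst//.
by apply: eq_integral => r _; exact: diracT.
Qed.

(* The law of DTCS(n). *)
Definition dtcs (n : nat) : set btree -> \bar R := dtcs_rec n n.

HB.instance Definition _ n := Measure.on (dtcs n).
HB.instance Definition _ n :=
  Measure_isProbability.Build _ _ R (dtcs n) (dtcs_rec_setT n n).

Lemma dtcs1 : dtcs 1 = \d_Leaf.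
Proof. by []. Qed.

Lemma dtcsE n (A : set btree) : (1 < n)%N ->
  dtcs n A = \sum_(1 <= i < n) (split_pmf n i)%:E *
    \int[dtcs i]_l \int[dtcs (n - i)]_r \d_(Node l r) A.
Proof.
case: n => // n n1; rewrite /dtcs dtcs_recS//.
apply: eq_big_nat => i /andP[i0 im]; congr (_ * _).
have jn : (n.+1 - i <= n)%N by rewrite leq_subLR -add1n leq_add2r.
rewrite (eq_measure_integral (dtcs_rec i i)); last first.
  by move=> B _ _; exact: dtcs_rec_fuel.
apply: eq_integral => l _; apply: eq_measure_integral => B _ _.
exact: dtcs_rec_fuel.
Qed.

End dtcs.

Definition Theta_whp (R : realType) d (T : measurableType d)
    (P : nat -> probability T R) (X : nat -> T -> R) (f : nat -> R) : Prop :=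
  exists c C : R, [/\ 0 < c, c < C &
    P n [set t | c * f n <= X n t <= C * f n] @[n --> \oo] --> 1%E].

(* Main.v *)
(* The transition is at clades with about log n leaves. At most 4^m shapes have
   m leaves or fewer, so for a small c all but a negligible number of shapes come
   from clades with at least k = c log n leaves. Conversely DTCS(m) takes no shape,
   even up to reordering, with probability above e^((4 - m) / 100), so for a large
   c all clades with at least k = c log n leaves have distinct unordered shapes
   with high probability. Both bounds thus reduce to the number M of clades with
   at least k leaves, which is of order n log k / k. Tail bounds for M come from
   its exponential moments: since E[exp(x M)] satisfies a recursion along the
   splits, E[exp(x M)] <= exp(G n) holds as soon as the explicit function G is a
   supersolution of that recursion. *)

Require Import Defs.
From HB Require Import structures.
From mathcomp Require Import all_boot all_order all_algebra.
From mathcomp Require Import ring lra zify.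
From mathcomp Require Import all_classical all_reals all_analysis.
From mathcomp Require Import giry.
Import Order.TTheory GRing.Theory Num.Theory.
Import numFieldNormedType.Exports.
Local Open Scope classical_set_scope.
Local Open Scope ring_scope.

Set Implicit Arguments.
Unset Strict Implicit.
Unset Printing Implicit Defensive.

(** * Expectation under the law of the tree *)

Fixpoint leaves (t : btree) : nat :=
  if t is Node l r then (leaves l + leaves r)%N else 1%N.

Lemma leaves_gt0 t : (0 < leaves t)%N.
Proof. by elim: t => //= l IHl r _; rewrite addn_gt0 IHl. Qed.

Section mean.
Context {R : realType}.
Implicit Types (F G : btree -> R) (n m i k : nat).

(* The expectation of F over dtcs_rec k m, as a finite sum in R instead of an
   integral (see integral_dtcs_rec); k is the recursion bound of dtcs_rec. *)
Fixpoint mean_rec k m F : R :=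
  if k is k'.+1 then
    if (m <= 1)%N then F Leaf
    else \sum_(1 <= i < m) split_pmf m i *
      mean_rec k' i (fun l => mean_rec k' (m - i) (fun r => F (Node l r)))
  else F Leaf.

Definition mean n F := mean_rec n n F.

Lemma mean_rec_ge0 k m F : (forall t, 0 <= F t) -> 0 <= mean_rec k m F.
Proof.
elim: k m F => [|k IH] m F F0 /=; first exact: F0.
case: ifP => // _.
apply: sumr_ge0 => i _; rewrite mulr_ge0 ?split_pmf_ge0//.
by apply: (IH) => l; exact: IH.
Qed.

Lemma integral_dtcs_rec k m F : (forall t, 0 <= F t) ->
  (\int[dtcs_rec k m]_t (F t)%:E = (mean_rec k m F)%:E)%E.
Proof.
elim: k m F => [|k IH] m F F0 /=.
  by rewrite integral_dirac// diracT mul1e.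
case: ifPn => m1; first by rewrite integral_dirac// diracT mul1e.
rewrite [LHS](@giry_int_bind _ _ _ _ _ _ _ _ (fun t => (F t)%:E))//.
rewrite /giry_int integral_split_prob ?ltnNge//; last first.
  by move=> i; apply: integral_ge0 => x _; rewrite lee_fin.
rewrite -sumEFin; apply: eq_bigr => i _; rewrite EFinM; congr (_ * _)%E.
rewrite [LHS](@giry_int_bind _ _ _ _ _ _ _ _ (fun t => (F t)%:E))//.
rewrite -IH; last by move=> l; exact: mean_rec_ge0.
apply: eq_integral => l _.
rewrite /= [LHS](@giry_int_bind _ _ _ _ _ _ _ _ (fun t => (F t)%:E))//.
rewrite -IH//; apply: eq_integral => r _.
by rewrite /giry_int integral_dirac// diracT mul1e.
Qed.

Lemma mean_rec_fuel k k' m F : (m <= k)%N -> (m <= k')%N ->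
  mean_rec k m F = mean_rec k' m F.
Proof.
elim: k k' m F => [|k IH] [|k'] m F //=; rewrite ?leqn0.
- by move=> /eqP ->.
- by move=> _ /eqP ->.
move=> mk mk'; case: ifPn => // m1.
apply: eq_big_nat => i im; congr (_ * _).
rewrite (IH k'); [|lia|lia]; congr mean_rec; apply: funext => l.
by apply: IH; lia.
Qed.

Lemma mean1 F : mean 1 F = F Leaf.
Proof. by []. Qed.

Lemma mean_split n F : (1 < n)%N -> mean n F = \sum_(1 <= i < n)
  split_pmf n i * mean i (fun l => mean (n - i) (fun r => F (Node l r))).
Proof.
case: n => // n n1; rewrite /mean/= ifN -?ltnNge//.
apply: eq_big_nat => i im; congr (_ * _).
rewrite (mean_rec_fuel (k' := i)); [|lia|lia]; congr mean_rec.
by apply: funext => l; apply: mean_rec_fuel; lia.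
Qed.

(** DTCS(n) is supported on trees with n leaves. For n = 0 the recursion returns [Leaf], which has
    one leaf, so this case is excluded. *)
Lemma ler_mean n F G : (0 < n)%N ->
  (forall t, leaves t = n -> F t <= G t) -> mean n F <= mean n G.
Proof.
elim/ltn_ind: n F G => -[|[|n]] // IH F G _ FG; first exact: FG.
rewrite !mean_split//; apply: ler_sum_nat => i im.
rewrite ler_wpM2l ?split_pmf_ge0//; apply: (IH); [lia|lia|] => l li.
by apply: IH; [lia|lia|] => r ri; apply: FG; rewrite /= li ri; lia.
Qed.

Lemma eq_mean n F G : (0 < n)%N ->
  (forall t, leaves t = n -> F t = G t) -> mean n F = mean n G.
Proof.
by move=> n0 FG; apply: le_anti; rewrite !ler_mean// => t /FG ->.
Qed.

Lemma mean_cst n c : mean n (fun=> c) = c.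
Proof.
elim/ltn_ind: n => -[|[|n]] // IH; rewrite mean_split//.
transitivity (\sum_(1 <= i < n.+2) split_pmf n.+2 i * c); last first.
  by rewrite -mulr_suml sum_split_pmf// mul1r.
by apply: eq_big_nat => i im; rewrite !IH//; lia.
Qed.

Lemma meanD n F G : mean n (fun t => F t + G t) = mean n F + mean n G.
Proof.
elim/ltn_ind: n F G => -[|[|n]] // IH F G; rewrite !mean_split//.
rewrite -big_split/=; apply: eq_big_nat => i im.
rewrite -mulrDr -IH; last by lia.
congr (_ * mean _ _); apply: funext => l.
by rewrite -IH//; lia.
Qed.

Lemma meanZ n c F : mean n (fun t => c * F t) = c * mean n F.
Proof.
elim/ltn_ind: n F => -[|[|n]] // IH F; rewrite !mean_split//.
rewrite mulr_sumr; apply: eq_big_nat => i im.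
rewrite mulrCA -IH; last by lia.
congr (_ * mean _ _); apply: funext => l.
by rewrite -IH//; lia.
Qed.

Lemma meanM i j F G :
  mean i (fun l => mean j (fun r => F l * G r)) = mean i F * mean j G.
Proof.
rewrite mulrC -meanZ; congr mean; apply: funext => l.
by rewrite meanZ mulrC.
Qed.

Lemma mean_ge0 n F : (forall t, 0 <= F t) -> 0 <= mean n F.
Proof. exact: mean_rec_ge0. Qed.

Lemma dtcs_mean n (A : set btree) :
  dtcs n A = (mean n (fun t => (t \in A)%:R))%:E :> \bar R.
Proof.
rewrite -integral_dtcs_rec//.
have := @integral_indic _ _ R (dtcs_rec n n) _ measurableT A I.
by rewrite setIT => ->.
Qed.

(** The induction step shared by all the bounds in expectation below: [f] bounds [F] at the root,
    and [u i] bounds the expectation of [f] given that the left part has i leaves. *)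
Lemma mean_node_le n F (f : btree -> btree -> R) (u : nat -> R) : (1 < n)%N ->
  (forall l r, leaves (Node l r) = n -> F (Node l r) <= f l r) ->
  (forall i, (0 < i < n)%N -> mean i (fun l => mean (n - i) (f l)) <= u i) ->
  mean n F <= \sum_(1 <= i < n) split_pmf n i * u i.
Proof.
move=> n1 Ff fu; rewrite mean_split//; apply: ler_sum_nat => i im.
rewrite ler_wpM2l ?split_pmf_ge0//; apply: le_trans (fu i _); last by lia.
apply: ler_mean; [lia|] => l li; apply: ler_mean; [lia|] => r ri.
by apply: Ff; rewrite /= li ri; lia.
Qed.

Lemma le_mean_split (n : nat) (u : nat -> R) c : (1 < n)%N ->
  (forall i, (0 < i < n)%N -> u i <= c) ->
  \sum_(1 <= i < n) split_pmf n i * u i <= c.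
Proof.
move=> n1 uc; rewrite -[leRHS]mul1r -(sum_split_pmf n1) mulr_suml.
by apply: ler_sum_nat => i im; rewrite ler_wpM2l ?split_pmf_ge0// uc.
Qed.

Lemma split_pmf_rev n i : (0 < i < n)%N ->
  split_pmf n (n - i) = split_pmf n i :> R.
Proof.
move=> im; rewrite /split_pmf im ifT; last by lia.
by rewrite subKn ?[(n - i)%:R * _]mulrC//; lia.
Qed.

End mean.

(** * Harmonic numbers and exponential moments *)

Section harmonic.
Context {R : realType}.
Local Notation h := (@harmonic_sum R).

Lemma harmonic_sumS k : h k.+1 = h k + k.+1%:R^-1.
Proof. by rewrite /harmonic_sum big_nat_recr. Qed.

Lemma harmonic_sum0 : h 0 = 0.
Proof. by rewrite /harmonic_sum big_geq. Qed.

Lemma le_harmonic_sum m n : (m <= n)%N -> h m <= h n.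
Proof.
move=> /subnK <-; elim: (n - m)%N => // d IH.
by rewrite addSn harmonic_sumS (le_trans IH)// lerDl invr_ge0.
Qed.

Lemma harmonic_sum_ge1 k : (0 < k)%N -> 1 <= h k.
Proof.
move=> k0; apply: le_trans (le_harmonic_sum k0).
by rewrite harmonic_sumS harmonic_sum0 add0r invr1.
Qed.

Lemma harmonic_sumD_le m d : (0 < m)%N -> h (m + d) - h m <= d%:R / m%:R.
Proof.
move=> m0; elim: d => [|d IH]; first by rewrite addn0 subrr mul0r.
rewrite addnS harmonic_sumS addrAC -[in leRHS]natr1 mulrDl mul1r lerD//.
by rewrite lef_pV2 ?posrE ?ltr0n// ler_nat; lia.
Qed.

(** The quotient is the average of the decreasing numbers 1/j for j <= n. *)
Lemma harmonic_sum_div_le m n : (0 < m <= n)%N -> h n / n%:R <= h m / m%:R.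
Proof.
move=> /andP[m0 /subnKC <-]; elim: (n - m)%N => [|d IH]; first by rewrite addn0.
apply: le_trans IH; rewrite addnS harmonic_sumS.
set k := (m + d)%N; have k0 : (0 < k)%N by rewrite /k; lia.
have k0R : 0 < k%:R :> R by rewrite ltr0n.
have hk : 1 <= h k by exact: harmonic_sum_ge1.
rewrite -natr1 -subr_ge0.
have -> : h k / k%:R - (h k + (k%:R + 1)^-1) / (k%:R + 1) =
    (h k - 1 + (k%:R + 1)^-1) / (k%:R * (k%:R + 1)).
  by field; rewrite !gt_eqF//; lra.
have k1R : 0 <= k%:R + 1 :> R by lra.
by rewrite divr_ge0 ?mulr_ge0 ?(ltW k0R)// addr_ge0 ?invr_ge0// subr_ge0.
Qed.

End harmonic.

Definition big_clades k t := count (fun s => k <= leaves s)%N (clades t).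

Lemma big_clades_node k l r : big_clades k (Node l r) =
  ((k <= leaves (Node l r)) + big_clades k l + big_clades k r)%N.
Proof. by rewrite /big_clades/= count_cat addnA. Qed.

Lemma big_clades_small k t : (leaves t < k)%N -> big_clades k t = 0%N.
Proof.
elim: t => //= l IHl r IHr tk; rewrite big_clades_node IHl ?IHr ?addn0 /=; lia.
Qed.

Section exponential_moment.
Context {R : realType}.
Local Notation h := (@harmonic_sum R).

(** Induction over the root split: given the sizes, the two subtrees are independent, and a root
    with at least k leaves contributes a factor [expR x]. Below k nothing is counted. The cap [N]
    lets [x] and [G] depend on the size of the whole tree. *)
Lemma mgf_big_clades_le (x : R) (G : nat -> R) k N : (1 < k)%N ->
  (forall n, (n < k)%N -> 0 <= G n) ->
  (forall n, (k <= n <= N)%N -> \sum_(1 <= i < n) split_pmf n i *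
    expR (x + G i + G (n - i)%N) <= expR (G n)) ->
  forall n, (0 < n <= N)%N ->
    mean n (fun t => expR (x * (big_clades k t)%:R)) <= expR (G n).
Proof.
move=> k1 G0 Gk; elim/ltn_ind => n IH /andP[n0 nN].
have [nk|kn] := ltnP n k.
  rewrite (@eq_mean _ _ _ (fun=> 1)) ?mean_cst//.
    by rewrite -expR0 ler_expR G0.
  by move=> t tn; rewrite big_clades_small ?mulr0 ?expR0// tn.
apply: le_trans (Gk _ _); last by rewrite kn.
pose F t := expR (x * (big_clades k t)%:R).
apply: (@mean_node_le _ _ _ (fun l r => expR x * F l * F r)).
- exact: leq_trans kn.
- move=> l r lr; rewrite big_clades_node lr kn /F -!expRD.
  by rewrite !natrD !mulrDr mulr1.
- move=> i i_n; rewrite (meanM i (n - i) (fun l => expR x * F l) F) meanZ.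
  rewrite !expRD ler_pM//; last by apply: IH; lia.
  - by rewrite mulr_ge0 ?expR_ge0//; apply: mean_ge0 => t; exact: expR_ge0.
  - by apply: mean_ge0 => t; exact: expR_ge0.
  - by rewrite ler_wpM2l ?expR_ge0//; apply: IH; lia.
Qed.

Lemma expRN_le_half (x : R) : 0 <= x <= 1 -> expR (- x) <= 1 - x / 2.
Proof.
move=> /andP[x0 x1]; rewrite expRN; have ex := expR_ge1Dx x.
apply: (@le_trans _ _ (1 + x)^-1); first by rewrite lef_pV2 ?posrE ?expR_gt0//; lra.
by rewrite -div1r ler_pdivrMr; [nra|lra].
Qed.

Lemma expR_le_double (x : R) : 0 <= x <= 2^-1 -> expR x <= 1 + 2 * x.
Proof.
move=> /andP[x0 x1]; rewrite -[x in expR x]opprK expRN.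
have ex := expR_ge1Dx (- x).
apply: (@le_trans _ _ (1 - x)^-1); first by rewrite lef_pV2 ?posrE ?expR_gt0//; lra.
by rewrite -div1r ler_pdivrMr; [nra|lra].
Qed.

End exponential_moment.

(** * Upper tail of the number of large clades: a supersolution *)

Section upper_exponential_moment.
Context {R : realType}.
Local Notation h := (@harmonic_sum R).

Lemma harmonic_sum_subadd i j : h (i + j) <= h i + h j.
Proof.
elim: j => [|j IH]; first by rewrite addn0 harmonic_sum0 addr0.
rewrite addnS !harmonic_sumS addrA lerD// lef_pV2 ?posrE ?ltr0n// ler_nat; lia.
Qed.

Let middle n i : bool := (n <= 4 * i)%N && (4 * i <= 3 * n)%N.

(** This is i (n - i) <= n^2 / 4; the difference of the two sides is a multiple of (n - 2 i)^2. *)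
Lemma split_pmf_middle n i : (1 < n)%N -> (0 < i < n)%N ->
  2 / (n%:R * h n.-1) <= split_pmf n i.
Proof.
move=> n1 i_n; rewrite /split_pmf i_n.
have h0 : 0 < h n.-1 by apply: harmonic_sum_gt0; lia.
have i0 : 0 < i%:R :> R by rewrite ltr0n; lia.
have ni : (n - i)%:R = n%:R - i%:R :> R by rewrite natrB//; lia.
have j0 : 0 < n%:R - i%:R :> R by rewrite -ni ltr0n; lia.
rewrite ni; move: (n%:R : R) (i%:R : R) (h n.-1) j0 i0 h0 => x y z j0 i0 h0.
have x0 : 0 < x by lra.
rewrite -subr_ge0.
have -> : x / (2 * z) / (y * (x - y)) - 2 / (x * z) =
    (x - 2 * y) ^+ 2 / (2 * x * y * z * (x - y)).
  by field; rewrite !gt_eqF//; lra.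
by rewrite divr_ge0 ?sqr_ge0// ltW// !mulr_gt0//; lra.
Qed.

Lemma sum_split_pmf_middle n : (1 < n)%N ->
  (2 * h n)^-1 <= \sum_(1 <= i < n) split_pmf n i * (middle n i)%:R.
Proof.
move=> n1; have h0 : 0 < h n.-1 by apply: harmonic_sum_gt0; lia.
have n0 : 0 < n%:R :> R by rewrite ltr0n; lia.
apply: (@le_trans _ _ (\sum_(1 <= i < n) 2 / (n%:R * h n.-1) * (middle n i)%:R)).
  rewrite -mulr_sumr -natr_sum.
  have cnt : (n <= 4 * \sum_(1 <= i < n) middle n i)%N.
    (* [m] is n / 4 rounded up, so [middle n i] means m <= i <= n - m. There are n - 2 m + 1 such i,
       at least n / 4 of them. *)
    pose m := ((n + 3) %/ 4)%N.
    rewrite (@big_cat_nat _ _ _ m)/=; [|rewrite /m; lia|rewrite /m; lia].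
    rewrite (@big_cat_nat _ _ _ (n - m).+1 m)/=; [|rewrite /m; lia|rewrite /m; lia].
    rewrite [X in (_ + (X + _))%N](_ : _ = \sum_(m <= i < (n - m).+1) 1)%N; last first.
      by apply: eq_big_nat => i im; rewrite /middle; move: im; rewrite /m => im; lia.
    by rewrite sum_nat_const_nat /m; lia.
  have cntR : n%:R / 4 <= (\sum_(1 <= i < n) middle n i)%N%:R :> R.
    by rewrite ler_pdivrMr// mulrC -(natrM _ 4) ler_nat.
  apply: (@le_trans _ _ (2 / (n%:R * h n.-1) * (n%:R / 4))).
    rewrite (_ : 2 / _ * _ = (2 * h n.-1)^-1); last by field; rewrite !gt_eqF.
    rewrite lef_pV2 ?posrE ?mulr_gt0//; first by rewrite ler_pM2l// le_harmonic_sum// leq_pred.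
    by rewrite (lt_le_trans h0)// le_harmonic_sum// leq_pred.
  by rewrite ler_wpM2l// divr_ge0// mulr_ge0// ltW.
apply: ler_sum_nat => i im; rewrite ler_wpM2r//.
exact: split_pmf_middle.
Qed.

(** Balanced splits, where each part has at least a quarter of the leaves, carry mass at least
    [(2 * h n)^-1], so a gain [c] on them alone lowers the average. *)
Lemma sum_split_pmf_gap n (e : nat -> R) c : (1 < n)%N ->
  (forall i, (0 < i < n)%N -> e i <= 1) ->
  (forall i, (n <= 4 * i <= 3 * n)%N -> e i <= 1 - c) -> 0 <= c ->
  \sum_(1 <= i < n) split_pmf n i * e i <= 1 - c / (2 * h n).
Proof.
move=> n1 e1 ec c0.
apply: (@le_trans _ _ (\sum_(1 <= i < n) (split_pmf n i -
    c * (split_pmf n i * (middle n i)%:R)))).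
  apply: ler_sum_nat => i im; rewrite mulrCA -[X in X - _]mulr1 -mulrBr.
  rewrite ler_wpM2l ?split_pmf_ge0//; case: (boolP (middle n i)) => mi.
    by rewrite mulr1 ec.
  by rewrite mulr0 subr0 e1.
rewrite sumrB sum_split_pmf// -mulr_sumr lerD2l lerN2 ler_wpM2l//.
exact: sum_split_pmf_middle.
Qed.

(* n * h K / K is the expected order of M, and the correction - h n is what
   each split of n into parts of comparable sizes gains: h i + h (n - i) - h n is
   of order h n, which compensates their probability, of order 1 / h n. *)
Definition upper_rate (a : R) n : R := Num.max 0 (a * n%:R - h n).

(** If both terms are positive, this is subadditivity of [h]. If only the one at j is, then a j > h
    j >= 1, so h (i + j) - h j <= i / j <= a i, and a x - h x is no smaller at i + j than at j. *)
Lemma upper_rate_superadd a i j : (0 < i)%N -> (0 < j)%N ->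
  upper_rate a i + upper_rate a j <= upper_rate a (i + j).
Proof.
wlog ij : i j / a * i%:R - h i <= a * j%:R - h j => [H|] i0 j0.
  have [|/ltW] := leP (a * i%:R - h i) (a * j%:R - h j); first by move/H; exact.
  by move/H => /(_ j0 i0); rewrite addrC [(j + i)%N]addnC.
have hi := harmonic_sum_subadd i j.
have hj := harmonic_sumD_le (R := R) i j0; rewrite addnC in hj.
have hj1 := harmonic_sum_ge1 (R := R) j0.
have jR : 0 < j%:R :> R by rewrite ltr0n.
have iR : 0 < i%:R :> R by rewrite ltr0n.
rewrite /upper_rate natrD.
have [gj|gj] := leP (a * j%:R - h j) 0.
  by rewrite (max_l (le_trans ij gj)) addr0 le_max lexx.
have [gi|gi] := leP (a * i%:R - h i) 0.
  rewrite add0r le_max; apply/orP; right.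
  have : i%:R / j%:R <= a * i%:R.
    rewrite ler_pdivrMr//; nra.
  lra.
by rewrite le_max; apply/orP; right; lra.
Qed.

(** All sizes are at least K, so no maximum with 0 intervenes; the linear terms cancel and leave h i
    + h (n - i) - h n. Each part has [h] within 3 of [h n], so this is at least h n - 6, which
    explains the 12. *)
Lemma upper_rate_middle K n i : (0 < K)%N -> (4 * K <= n)%N -> 12 <= h n ->
  (n <= 4 * i <= 3 * n)%N ->
  h n / 2 <= upper_rate (h K / K%:R) n - upper_rate (h K / K%:R) i
    - upper_rate (h K / K%:R) (n - i).
Proof.
move=> K0 Kn hn i_n.
have rateE m : (K <= m)%N ->
    upper_rate (h K / K%:R) m = h K / K%:R * m%:R - h m.
  move=> Km; rewrite /upper_rate max_r// subr_ge0 -ler_pdivrMr ?ltr0n; last by lia.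
  by apply: harmonic_sum_div_le; rewrite K0.
rewrite !rateE; [|lia|lia|lia].
have -> : n%:R = i%:R + (n - i)%:R :> R by rewrite -natrD subnKC//; lia.
have hd m : (n <= 4 * m)%N -> (m <= n)%N -> h n - h m <= 3.
  move=> nm mn; rewrite -(subnKC mn); apply: le_trans (harmonic_sumD_le _ _) _; first by lia.
  rewrite ler_pdivrMr ?ltr0n; last by lia.
  by rewrite -natrM ler_nat; lia.
have hi : h n - h i <= 3 by apply: hd; lia.
have hj : h n - h (n - i) <= 3 by apply: hd; lia.
lra.
Qed.

Lemma mgf_big_clades_upper K N n : (0 < K)%N -> 12 <= h (4 * K) ->
  (0 < n <= N)%N ->
  mean n (fun t => expR ((16 * h N)^-1 * (big_clades (4 * K) t)%:R)) <=
  expR ((2 * h N)^-1 * upper_rate (h K / K%:R) n).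
Proof.
move=> K0 hK nN; have hN : 0 < h N by apply: harmonic_sum_gt0; lia.
(* This scale keeps the gain [B * h n / 2] of a balanced split at most 1 for all n <= N, as
   [expRN_le_half] requires. *)
set B := (2 * h N)^-1.
have -> : (16 * h N)^-1 = B / 8 by rewrite /B; field; rewrite gt_eqF.
have B0 : 0 < B by rewrite invr_gt0 mulr_gt0.
set g := upper_rate _.
apply: (@mgf_big_clades_le _ _ (fun m => B * g m) (4 * K) N) => //.
- lia.
- by move=> m _; rewrite mulr_ge0 ?(ltW B0)// le_max lexx.
move=> {n nN} n /andP[Kn nN]; have n1 : (1 < n)%N by lia.
have hn : 12 <= h n by apply: le_trans hK _; exact: le_harmonic_sum.
have hnN : h n <= h N by exact: le_harmonic_sum.
pose d i := B * (g n - g i - g (n - i)%N).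
under eq_bigr => i _.
  rewrite (_ : B / 8 + _ + _ = (B / 8 + B * g n) - d i); last by rewrite /d; ring.
  rewrite expRD mulrCA; over.
rewrite -mulr_sumr addrC expRD -mulrA ler_piMr ?expR_ge0//.
have Bh : 0 <= B * h n / 2 <= 1.
  rewrite !mulr_ge0 ?(ltW B0)//=; last by lra.
  by rewrite ler_pdivrMr// /B mulrC ler_pdivrMr ?mulr_gt0//; lra.
apply: (@le_trans _ _ (expR (B / 8) * (1 - B / 8))); last first.
  rewrite -ler_pdivlMl ?expR_gt0// mulr1 -expRN.
  exact: (expR_ge1Dx (- (B / 8))).
rewrite ler_wpM2l ?expR_ge0//.
(* A balanced split gives a factor at most 1 - B h n / 4 and has probability at least 1 / (2 h n).
   The average loses their product B / 8, which is free of n and pays for the root's factor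
   [expR (B / 8)]. *)
rewrite [B / 8](_ : _ = B * h n / 2 / 2 / (2 * h n)); last by field; lra.
apply: sum_split_pmf_gap => //; last by lra.
- move=> i i_n; rewrite -expR0 ler_expR oppr_le0 mulr_ge0 ?(ltW B0)//.
  have /andP[i0 i1] := i_n; have ni : (0 < n - i)%N by rewrite subn_gt0.
  have := upper_rate_superadd (h K / K%:R) i0 ni.
  by rewrite (subnKC (ltnW i1)) -/g => ?; lra.
- move=> i i_n; apply: le_trans (expRN_le_half Bh).
  by rewrite ler_expR lerN2 -mulrA ler_pM2l//; exact: upper_rate_middle.
Qed.

End upper_exponential_moment.

(** * Lower tail of the number of large clades: a supersolution *)

Section lower_exponential_moment.
Context {R : realType}.
Local Notation h := (@harmonic_sum R).

(* The function x - deficit k x is nonpositive for x <= k and is close to x for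
   x >> k. The gain deficit i + deficit (n - i) - deficit n of a split is at most
   twice the deficit of the smaller part, which is small both when this part
   is << k and when it is >> k: averaged over the split it is O(k / h n). *)
Definition deficit (k x : R) : R := 2 * x * k ^+ 2 / (x ^+ 2 + k ^+ 2).

Lemma deficit_ge0 k x : 0 <= x -> 0 <= deficit k x.
Proof.
move=> x0; rewrite /deficit divr_ge0 ?addr_ge0 ?sqr_ge0//.
by rewrite mulr_ge0 ?sqr_ge0// mulr_ge0.
Qed.

Lemma deficit_le k x : 0 < k -> deficit k x <= k.
Proof.
move=> k0; rewrite /deficit ler_pdivrMr; last by rewrite ltr_wpDl ?sqr_ge0 ?exprn_gt0.
have := sqr_ge0 (x - k); nra.
Qed.

Lemma le_deficit k x : 0 < k -> 0 <= x <= k -> x <= deficit k x.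
Proof.
move=> k0 /andP[x0 xk].
rewrite /deficit ler_pdivlMr; last by rewrite ltr_wpDl ?sqr_ge0 ?exprn_gt0.
have -> : 2 * x * k ^+ 2 = x * (k ^+ 2 + k ^+ 2) by ring.
by rewrite ler_wpM2l// lerD2r; nra.
Qed.

Lemma deficit_decrease k x y : 0 < k -> 0 < x <= y ->
  deficit k y - deficit k (x + y) <= deficit k x.
Proof.
move=> k0 /andP[x0 xy]; have y0 : 0 < y by lra.
have k2 : 0 < k ^+ 2 by rewrite exprn_gt0.
have p z : 0 < z ^+ 2 + k ^+ 2 by rewrite ltr_wpDl ?sqr_ge0.
(* As x <= y, passing to the denominator y^2 + k^2 lowers the right side; what then remains is a
   quotient of nonnegative polynomials. *)
apply: (@le_trans _ _ (2 * x * k ^+ 2 / (y ^+ 2 + k ^+ 2))); last first.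
  rewrite /deficit ler_wpM2l//; first by rewrite mulr_ge0 ?(ltW k2)// mulr_ge0// ltW.
  by rewrite lef_pV2 ?posrE// lerD2r; nra.
rewrite -subr_ge0 /deficit.
have -> : 2 * x * k ^+ 2 / (y ^+ 2 + k ^+ 2) -
   (2 * y * k ^+ 2 / (y ^+ 2 + k ^+ 2) -
    2 * (x + y) * k ^+ 2 / ((x + y) ^+ 2 + k ^+ 2)) =
   2 * x * k ^+ 2 * ((x + y) * x + 2 * k ^+ 2) /
    ((y ^+ 2 + k ^+ 2) * ((x + y) ^+ 2 + k ^+ 2)).
  by field; rewrite !gt_eqF.
apply: divr_ge0; last by rewrite mulr_ge0 ?ltW.
by rewrite !mulr_ge0 ?addr_ge0 ?mulr_ge0//; lra.
Qed.

(** Since 2 (i^2 + k^2) >= (i + k)^2, the term 2 k^2 / (i^2 + k^2) is at most 4 k^2 / ((i + k - 1)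
    (i + k)), which telescopes. *)
Lemma sum_deficit_le (k n : nat) : (0 < k)%N ->
  \sum_(1 <= i < n.+1) deficit k%:R i%:R / i%:R <= 4 * k%:R.
Proof.
move=> k0; have kR : 0 < k%:R :> R by rewrite ltr0n.
apply: (@le_trans _ _ (4 * k%:R - 4 * k%:R ^+ 2 / (n + k)%:R)); last first.
  by rewrite gerBl divr_ge0 ?mulr_ge0 ?sqr_ge0.
elim: n => [|n IH].
  by rewrite big_geq// add0n expr2 mulrA mulfK ?subrr// gt_eqF.
rewrite big_nat_recr//=; apply: le_trans (lerD IH (lexx _)) _.
rewrite addSn -!natr1 natrD /deficit; move: (n%:R : R) (ler0n R n) => x x0.
rewrite -subr_ge0.
set y := k%:R in kR *.
have p : 0 < (x + 1) ^+ 2 + y ^+ 2 by rewrite ltr_wpDl ?sqr_ge0 ?exprn_gt0.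
rewrite [X in 0 <= X](_ : _ = 2 * y ^+ 2 * ((x + 1 - y) ^+ 2 + x + y + 1) /
  ((x + y) * (x + y + 1) * ((x + 1) ^+ 2 + y ^+ 2))); last first.
  by field; rewrite !gt_eqF//; lra.
rewrite divr_ge0//; last by rewrite !mulr_ge0 ?(ltW p)//; lra.
rewrite !mulr_ge0 ?sqr_ge0//; have := sqr_ge0 (x + 1 - y); lra.
Qed.

(** The larger part is at least n / 2. *)
Lemma split_pmf_le n i : (1 < n)%N -> (0 < i < n)%N ->
  split_pmf n i <= (h n.-1 * (minn i (n - i))%:R)^-1.
Proof.
wlog ij : i / (i <= n - i)%N => [H|] n1 i_n.
  have [/H/(_ n1 i_n)//|] := boolP (i <= n - i)%N; rewrite -ltnNge => /ltnW ij.
  have : split_pmf n (n - i) <= (h n.-1 * (minn (n - i) (n - (n - i)))%:R)^-1.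
    by apply: H; lia.
  by rewrite subKn ?split_pmf_rev 1?minnC//; lia.
rewrite (minn_idPl ij) /split_pmf i_n.
have h0 : 0 < h n.-1 by apply: harmonic_sum_gt0; lia.
have i0 : 0 < i%:R :> R by rewrite ltr0n; lia.
have j0 : 0 < (n - i)%:R :> R by rewrite ltr0n; lia.
have -> : n%:R = i%:R + (n - i)%:R :> R by rewrite -natrD subnKC//; lia.
have : i%:R <= (n - i)%:R :> R by rewrite ler_nat.
move: (i%:R : R) ((n - i)%:R : R) (h n.-1) i0 j0 h0 => x y z x0 y0 z0 xy.
rewrite -subr_ge0.
have -> : (z * x)^-1 - (x + y) / (2 * z) / (x * y) = (y - x) / (2 * x * y * z).
  by field; rewrite !gt_eqF.
by rewrite divr_ge0 ?subr_ge0// ltW// !mulr_gt0.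
Qed.

(** With the divisor [4 * k], a split gains at most the deficit of its smaller part over 2 k, hence
    at most 1/2, the range of [expR_le_double]. *)
Definition lower_rate k n : R := (n%:R - deficit k%:R n%:R) / (4 * k%:R).

Lemma mgf_big_clades_lower k n : (1 < k)%N -> (0 < n)%N ->
  mean n (fun t => expR (- (8 / h k.-1) * (big_clades k t)%:R)) <=
  expR (- lower_rate k n).
Proof.
move=> k1 n0; have kR : 0 < k%:R :> R by rewrite ltr0n; lia.
have hk : 0 < h k.-1 by apply: harmonic_sum_gt0; lia.
apply: (@mgf_big_clades_le _ _ (fun m => - lower_rate k m) k n) => //; last 1 first.
- by rewrite n0 leqnn.
- move=> m mk; rewrite oppr_ge0 /lower_rate pmulr_lle0 ?invr_gt0 ?mulr_gt0//.
  by rewrite subr_le0 le_deficit// ler0n ler_nat ltnW.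
move=> {n0} {}n /andP[kn _]; have n1 : (1 < n)%N by lia.
have hn : 0 < h n.-1 by apply: harmonic_sum_gt0; lia.
pose d i := lower_rate k n - lower_rate k i - lower_rate k (n - i)%N.
under eq_bigr => i _.
  rewrite (_ : _ + _ + _ = (- (8 / h k.-1) - lower_rate k n) + d i); last by rewrite /d; ring.
  rewrite expRD mulrCA; over.
rewrite -mulr_sumr addrC expRD -mulrA ler_piMr ?expR_ge0//.
rewrite mulrC expRN ler_pdivrMr ?expR_gt0// mul1r.
pose j i := minn i (n - i).
have dj i : (0 < i < n)%N -> d i <= deficit k%:R (j i)%:R / (2 * k%:R).
  move=> i_n.
  wlog ij : i i_n / (i <= n - i)%N => [H|].
    have [|/ltnW ij] := leqP i (n - i); first exact: H.
    have : d (n - i)%N <= deficit k%:R (j (n - i)%N)%:R / (2 * k%:R).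
      by apply: H; lia.
    rewrite /d /j subKn; last by lia.
    by rewrite minnC; lra.
  rewrite /j (minn_idPl ij) /d /lower_rate.
  have dec : deficit k%:R (n - i)%:R - deficit k%:R n%:R <= deficit k%:R i%:R.
    rewrite [in n%:R](_ : n = i + (n - i))%N ?natrD; last by lia.
    by apply: deficit_decrease => //; rewrite ltr0n ler_nat ij; lia.
  have nE : n%:R = i%:R + (n - i)%:R :> R by rewrite -natrD subnKC//; lia.
  move: (deficit _ n%:R) dec => dn dec; rewrite nE -subr_ge0.
  set x := deficit _ _ in dec *; set y := deficit _ _ in dec *.
  rewrite [X in 0 <= X](_ : _ = (y + dn - x) / (4 * k%:R)); last first.
    by field; rewrite gt_eqF.
  by rewrite divr_ge0 ?mulr_ge0 ?(ltW kR)//; lra.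
apply: (@le_trans _ _ (\sum_(1 <= i < n) split_pmf n i *
    (1 + deficit k%:R (j i)%:R / k%:R))).
  apply: ler_sum_nat => i i_n; rewrite ler_wpM2l ?split_pmf_ge0//.
  apply: (@le_trans _ _ (expR (deficit k%:R (j i)%:R / (2 * k%:R)))).
    by rewrite ler_expR dj.
  apply: le_trans (expR_le_double _) _.
    have := deficit_le (j i)%:R kR; have := deficit_ge0 k%:R (ler0n R (j i)).
    move: (deficit _ _) => z z0 zk; rewrite divr_ge0//= ?mulr_ge0//.
    by rewrite ler_pdivrMr ?mulr_gt0// mulKf.
  by rewrite lerD2l mulrCA invfM mulVKf.
apply: (@le_trans _ _ (1 + 8 / h k.-1)); last exact: expR_ge1Dx.
under eq_bigr => i _ do rewrite mulrDr mulr1.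
rewrite big_split/= sum_split_pmf// lerD2l.
(* The term of the smaller part is at most the sum of the terms of both parts. By symmetry these
   have equal sums, each at most 4 k by [sum_deficit_le]; hence the 8. *)
apply: (@le_trans _ _ (\sum_(1 <= i < n) (h n.-1 * k%:R)^-1 *
   (deficit k%:R i%:R / i%:R + deficit k%:R (n - i)%:R / (n - i)%:R))).
  apply: ler_sum_nat => i i_n.
  have jR : 0 < (j i)%:R :> R by rewrite ltr0n /j leq_min; lia.
  apply: (@le_trans _ _ ((h n.-1 * (j i)%:R)^-1 * (deficit k%:R (j i)%:R / k%:R))).
    by rewrite ler_wpM2r ?split_pmf_le// divr_ge0 ?deficit_ge0.
  rewrite (_ : _ * (_ / _) =
      (h n.-1 * k%:R)^-1 * (deficit k%:R (j i)%:R / (j i)%:R)); last first.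
    by field; rewrite !gt_eqF.
  rewrite ler_wpM2l ?invr_ge0//; first by rewrite ltW ?mulr_gt0.
  by rewrite /j; case: leqP => _; rewrite ?lerDl ?lerDr divr_ge0 ?deficit_ge0.
rewrite -mulr_sumr big_split/= [X in _ + X](_ : _ =
    \sum_(1 <= i < n) deficit k%:R i%:R / i%:R); last first.
  rewrite [RHS]big_nat_rev/=; apply: eq_big_nat => i _.
  by rewrite add1n subSS.
have := @sum_deficit_le k n.-1; rewrite prednK; last by lia.
move=> /(_ (ltnW k1)); set S := \sum_(1 <= i < n) _ => Sk.
apply: (@le_trans _ _ ((h n.-1 * k%:R)^-1 * (8 * k%:R))).
  by rewrite ler_wpM2l ?invr_ge0//; [rewrite ltW ?mulr_gt0|lra].
rewrite (_ : _ * _ = 8 / h n.-1); last by field; rewrite !gt_eqF.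
rewrite ler_wpM2l// lef_pV2 ?posrE// le_harmonic_sum//; lia.
Qed.

End lower_exponential_moment.

(** * Coincidences between large clades *)

Lemma uiso_leaves s t : uiso s t -> leaves s = leaves t.
Proof.
elim: s t => [|l IHl r IHr] [|l' r'] //= /orP[] /andP[/IHl -> /IHr ->] //.
by rewrite addnC.
Qed.

Lemma size_clades t : size (clades t) = (leaves t).-1.
Proof.
elim: t => //= l IHl r IHr; rewrite size_cat IHl IHr.
by have := leaves_gt0 l; have := leaves_gt0 r; lia.
Qed.

Lemma clades_leaves t s : s \in clades t -> (leaves s <= leaves t)%N.
Proof.
elim: t => //= l IHl r IHr; rewrite inE mem_cat => /orP[/eqP -> //|].
by case/orP=> [/IHl|/IHr]; lia.
Qed.

(* Pairs of clades of equal unordered shape, the first with at least k leaves;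
   nested clades are left out, as their numbers of leaves differ. *)
Fixpoint twins k t : nat :=
  if t is Node l r then
    (twins k l + twins k r +
      \sum_(s <- clades l | (k <= leaves s)%N) count (uiso^~ s) (clades r))%N
  else 0%N.

(** Without twins, no large clade of [l] matches one of [r], and the root has more leaves than any
    other clade. *)
Lemma uniq_shape_u_clades k t : twins k t = 0%N ->
  uniq [seq shape_u s | s <- clades t & (k <= leaves s)%N].
Proof.
elim: t => //= l IHl r IHr.
move/eqP; rewrite !addn_eq0 => /andP[/andP[/eqP/IHl ul /eqP/IHr ur]].
rewrite sum_nat_seq_eq0 => /allP tw.
have uc : uniq [seq shape_u s | s <- clades l ++ clades r & (k <= leaves s)%N].
  rewrite filter_cat map_cat cat_uniq ul ur andbT /=.
  apply/hasPn => _ /mapP[s + ->]; rewrite mem_filter => /andP[ks sr].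
  apply/negP => /mapP[s' + /esym/shape_uP s's]; rewrite mem_filter => /andP[ks' sl].
  have := tw _ sl; rewrite ks'/= => /eqP/eqP; rewrite -leqn0 leqNgt -has_count => /hasPn/(_ _ sr).
  by rewrite /= uiso_sym s's.
case: ifP => // kn; rewrite /= uc andbT; apply/negP => /mapP[s + /shape_uP/uiso_leaves].
rewrite mem_filter mem_cat => /andP[_ /orP[]/clades_leaves] /=.
- by have := leaves_gt0 r; lia.
- by have := leaves_gt0 l; lia.
Qed.

Lemma big_clades_le_shapes k t : twins k t = 0%N ->
  (big_clades k t <= num_clade_shapes_u t)%N.
Proof.
move=> /uniq_shape_u_clades u; rewrite num_clade_shapes_uE /big_clades -size_filter.
rewrite -(size_map shape_u); apply: uniq_leq_size => // x /mapP[s].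
by rewrite mem_filter => /andP[_ st] ->; rewrite mem_undup map_f.
Qed.

Lemma num_clade_shapes_u_le t : (num_clade_shapes_u t <= num_clade_shapes t)%N.
Proof.
rewrite num_clade_shapes_uE num_clade_shapesE -(size_map shape_u).
apply: uniq_leq_size; first exact: undup_uniq.
by move=> x; rewrite mem_undup => /mapP[s st ->]; rewrite map_f// mem_undup.
Qed.

Section coincidences.
Context {R : realType}.
Local Notation h := (@harmonic_sum R).

Lemma mean_sum n (S : seq btree) (P : pred btree) (F : btree -> btree -> R) :
  mean n (fun t => \sum_(s <- S | P s) F s t) = \sum_(s <- S | P s) mean n (F s).
Proof.
elim: S => [|s S IH].
  by rewrite big_nil; under eq_fun do rewrite big_nil; rewrite mean_cst.
rewrite big_cons -IH; case: ifP => Ps; last first.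
  by congr mean; apply: funext => t; rewrite big_cons Ps.
by rewrite -meanD; congr mean; apply: funext => t; rewrite big_cons Ps.
Qed.

(** The factor 2 stands for the two ways to place the children of an unordered shape. From n = 5 on,
    2 / h (n - 1) is below 1, as h 4 = 25/12. *)
Lemma split_pmf_le_half n i : (4 < n)%N -> 2 * split_pmf n i <= 24 / 25 :> R.
Proof.
move=> n4; have [i_n|i_n] := boolP (0 < i < n)%N; last first.
  by rewrite /split_pmf (negbTE i_n); lra.
have h4 : h 4 = 25 / 12 by rewrite !harmonic_sumS harmonic_sum0; field.
have hn : 25 / 12 <= h n.-1 by rewrite -h4 le_harmonic_sum; lia.
have : split_pmf n i <= (25 / 12)^-1 :> R; last by lra.
apply: le_trans (split_pmf_le _ i_n) _; first by lia.
have m0 : (0 < minn i (n - i))%N by rewrite leq_min; lia.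
have h0 : 0 < h n.-1 by lra.
rewrite lef_pV2 ?posrE; [|rewrite mulr_gt0// ltr0n//|lra].
rewrite -[leLHS]mulr1 ler_pM//.
by rewrite ler1n.
Qed.

Lemma mean_uiso_eq0 n chi : (0 < n)%N -> leaves chi != n ->
  mean n (fun t => (uiso t chi)%:R) = 0 :> R.
Proof.
move=> n0 chin; rewrite (@eq_mean _ _ _ (fun=> 0)) ?mean_cst// => t tn.
by case: (boolP (uiso t chi)) => // /uiso_leaves; rewrite tn => /eqP; rewrite eq_sym (negbTE chin).
Qed.

(** By induction the subtrees contribute e^((8 - n) / 100), too much by a factor e^(4 / 100). Twice
    the split probability makes up for it, being at most 24/25 = 1 - 4/100 <= e^(-4 / 100). For n <=
    4 the bound is at least 1. *)
Lemma mean_uiso_le n chi : (0 < n)%N ->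
  mean n (fun t => (uiso t chi)%:R) <= expR ((4 - n%:R) / 100) :> R.
Proof.
elim/ltn_ind: n chi => n IH chi n0; have [n4|n4] := leqP n 4.
  apply: (@le_trans _ _ 1); last first.
    by rewrite -[leLHS]expR0 ler_expR divr_ge0// subr_ge0 ler_nat.
  rewrite -[leRHS](@mean_cst R n 1); apply: ler_mean => // t _.
  by case: (uiso t chi).
have [chin|chin] := eqVneq (leaves chi) n; last first.
  by rewrite mean_uiso_eq0// expR_ge0.
case: chi chin => [|A B] /= chin; first by lia.
pose P i s : R := mean i (fun t => (uiso t s)%:R).
have P0 i s : 0 <= P i s by exact: mean_ge0.
apply: (@le_trans _ _ (\sum_(1 <= i < n) split_pmf n i *
    (P i A * P (n - i)%N B + P i B * P (n - i)%N A))).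
  apply: (@mean_node_le _ _ _ (fun l r => (uiso l A)%:R * (uiso r B)%:R +
    (uiso l B)%:R * (uiso r A)%:R)); first by lia.
    move=> l r _ /=; rewrite -!natrM !mulnb -natrD ler_nat.
    by case: (_ && _) => //; case: (_ && _).
  move=> i i_n; under eq_fun do rewrite meanD.
  by rewrite meanD !(meanM i (n - i) (fun l => (uiso l _)%:R) (fun r => (uiso r _)%:R)).
pose e : R := expR ((8 - n%:R) / 100).
have PP s s' i : (0 < i < n)%N ->
    P i s * P (n - i)%N s' <= (i == leaves s)%:R * e.
  move=> i_n; case: eqP => [si|/eqP si]; last first.
    by rewrite [P i s]mean_uiso_eq0 ?mul0r// 1?eq_sym//; lia.
  have -> : e = expR ((4 - i%:R) / 100) * expR ((4 - (n - i)%:R) / 100).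
    rewrite -expRD /e natrB; last by lia.
    by congr expR; field.
  by rewrite mul1r ler_pM//; apply: IH; lia.
apply: (@le_trans _ _ (\sum_(1 <= i < n) (split_pmf n i * (i == leaves A)%:R * e +
    split_pmf n i * (i == leaves B)%:R * e))).
  apply: ler_sum_nat => i i_n; rewrite -!mulrA -mulrDr ler_wpM2l ?split_pmf_ge0//.
  by rewrite lerD// PP.
have pick a : (0 < a < n)%N ->
    \sum_(1 <= i < n) split_pmf n i * (i == a)%:R * e = split_pmf n a * e.
  move=> an; rewrite (@big_cat_nat _ _ _ a)/=; [|lia|lia].
  rewrite big_nat big1 ?add0r; last first.
    by move=> i ia; rewrite (_ : i == a = false) ?mulr0 ?mul0r//; lia.
  rewrite big_ltn; last by lia.
  rewrite eqxx mulr1 big_nat big1 ?addr0// => i ia.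
  by rewrite (_ : i == a = false) ?mulr0 ?mul0r//; lia.
have A0 := leaves_gt0 A; have B0 := leaves_gt0 B.
rewrite big_split/= !pick; [|lia|lia].
have -> : leaves B = (n - leaves A)%N by lia.
rewrite split_pmf_rev; last by lia.
have -> : expR ((4 - n%:R) / 100) = expR (- (4 / 100)) * e.
  by rewrite /e -expRD; congr expR; field.
rewrite -mulrDl ler_wpM2r ?expR_ge0//.
apply: le_trans (expR_ge1Dx _).
have := split_pmf_le_half (leaves A) n4; lra.
Qed.

(** There are n - 1 clades, and each, given its number m of leaves, is distributed as DTCS(m). *)
Lemma mean_count_uiso_le n chi (p : R) : (0 < n)%N ->
  (forall m, (0 < m)%N -> mean m (fun t => (uiso t chi)%:R) <= p) ->
  mean n (fun t => (count (uiso^~ chi) (clades t))%:R) <= (n%:R - 1) * p.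
Proof.
move=> + pP; elim/ltn_ind: n => -[|[|n]] // IH _.
  by rewrite mean1 subrr mul0r.
set N := n.+2 in IH *.
pose F t : R := (count (uiso^~ chi) (clades t))%:R.
rewrite (@eq_mean _ _ _ (fun t => (uiso t chi)%:R +
   (if t is Node l r then F l + F r else 0)))//; last first.
  by case=> [|l r] //= _; rewrite natrD count_cat natrD.
rewrite meanD.
apply: (@le_trans _ _ (p + (N%:R - 2) * p)); last by rewrite mulrBl mulrBl; lra.
rewrite lerD ?pP//.
apply: (@le_trans _ _ (\sum_(1 <= i < N) split_pmf N i * ((N%:R - 2) * p))); last first.
  exact: le_mean_split.
apply: (@mean_node_le _ _ _ (fun l r => F l + F r)) => // i i_n.
under eq_fun do rewrite meanD mean_cst.
rewrite meanD mean_cst.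
apply: le_trans (lerD (IH i _ _) (IH (N - i)%N _ _)) _; [lia|lia|lia|lia|].
rewrite natrB; last by lia.
by rewrite -mulrDl [X in X * p](_ : _ = N%:R - 2)//; ring.
Qed.

(** By independence, each of the i - 1 clades on the left is expected to match at most (n - i) p
    clades on the right, and i^2 + (n - i)^2 + i (n - i) <= n^2 closes the induction. *)
Lemma mean_twins_le n k : (0 < n)%N ->
  mean n (fun t => (twins k t)%:R) <= n%:R ^+ 2 * expR ((4 - k%:R) / 100) :> R.
Proof.
set p := expR _; have p0 : 0 <= p by exact: expR_ge0.
elim/ltn_ind: n => -[|[|n]] // IH _.
  by rewrite mean1 expr1n mul1r.
set N := n.+2 in IH *.
pose c l r := (\sum_(s <- clades l | (k <= leaves s)%N) count (uiso^~ s) (clades r))%N.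
apply: (@le_trans _ _ (\sum_(1 <= i < N) split_pmf N i * (N%:R ^+ 2 * p))); last first.
  exact: le_mean_split.
apply: (@mean_node_le _ _ _ (fun l r => (twins k l)%:R + ((twins k r)%:R + (c l r)%:R))) => //.
  by move=> l r _; rewrite /= !natrD addrA.
move=> i i_n; under eq_fun do rewrite meanD meanD mean_cst.
rewrite meanD meanD mean_cst.
have cle : mean i (fun l => mean (N - i) (fun r => (c l r)%:R)) <= i%:R * (N - i)%:R * p.
  rewrite -(@mean_cst R i (i%:R * (N - i)%:R * p)); apply: ler_mean; first by lia.
  move=> l li; under eq_fun do rewrite /c natr_sum; rewrite mean_sum.
  apply: (@le_trans _ _ (\sum_(s <- clades l) (N - i)%:R * p)); last first.
    rewrite big_const_seq count_predT iter_addr_0 size_clades li -mulrA.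
    rewrite -[leLHS]mulr_natl ler_wpM2r ?mulr_ge0// ler_nat; lia.
  rewrite [leLHS]big_mkcond/=; apply: ler_sum => s _; case: ifP => [ks|_]; last by rewrite mulr_ge0.
  apply: (@le_trans _ _ (((N - i)%:R - 1) * p)); last by rewrite ler_wpM2r// gerBl.
  apply: mean_count_uiso_le; first by lia.
  (* A match forces m = leaves s >= k, which turns a bound in m into one in k. *)
  move=> m m0; have [sm|sm] := eqVneq (leaves s) m; last by rewrite mean_uiso_eq0.
  apply: le_trans (mean_uiso_le _ m0) _.
  by rewrite ler_expR ler_wpM2r ?invr_ge0// lerD2l lerN2 ler_nat -sm.
apply: le_trans (lerD (IH i _ _) (lerD (IH (N - i)%N _ _) cle)) _; [lia|lia|lia|lia|].
have -> : N%:R = i%:R + (N - i)%:R :> R by rewrite -natrD subnKC//; lia.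
rewrite -!mulrDl ler_wpM2r//.
have : 0 <= i%:R * (N - i)%:R :> R by rewrite mulr_ge0.
nra.
Qed.

End coincidences.

(** * Counting small shapes *)

(** All trees of height less than [d], which include those with at most [d] leaves; height makes the
    recursion a plain product. *)
Fixpoint trees (d : nat) : seq btree :=
  if d is d'.+1 then Leaf :: [seq Node l r | l <- trees d', r <- trees d']
  else [::].

Lemma mem_trees d t : (leaves t <= d)%N -> t \in trees d.
Proof.
elim: d t => [|d IH] [|l r]; rewrite ?leqn0 ?gtn_eqF ?leaves_gt0// => td.
rewrite inE /=; apply/allpairsP; exists (l, r).
have /= := td; have := leaves_gt0 l; have := leaves_gt0 r => r0 l0 lr.
by split=> //=; apply: IH; lia.
Qed.

Lemma uniq_trees d : uniq (trees d).
Proof.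
elim: d => //= d IH; rewrite allpairs_uniq// ?andbT.
  by apply/negP => /allpairsP[[l r] []].
by move=> [l r] [l' r'] _ _ /= [-> ->].
Qed.

(* Kraft's inequality; the bound 1/2 is the fixed point of x = 1/4 + x^2. *)
Lemma kraft_trees d : \sum_(t <- trees d) 4^-1 ^+ leaves t <= 2^-1 :> rat.
Proof.
elim: d => [|d IH] /=; first by rewrite big_nil.
rewrite big_cons expr1 big_allpairs_dep/=.
under eq_bigr do under eq_bigr do rewrite exprD.
rewrite -big_distrlr/=.
move: IH; set S := \sum_(t <- _) _ => IH.
have S0 : 0 <= S by apply: sumr_ge0 => t _; rewrite exprn_ge0.
nra.
Qed.

(** Each member of [S] has weight at least 4^-k in the sum of [kraft_trees]. *)
Lemma size_small_trees k (S : seq btree) : uniq S ->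
  (forall t, t \in S -> leaves t <= k)%N -> (size S <= 4 ^ k)%N.
Proof.
move=> uS Sk.
have : \sum_(t <- S) 4^-1 ^+ leaves t <= 2^-1 :> rat.
  apply: le_trans (kraft_trees k).
  rewrite (perm_big [seq t <- trees k | t \in S])/=; last first.
    apply: uniq_perm; rewrite ?filter_uniq ?uniq_trees// => t.
    by rewrite mem_filter; case: (boolP (t \in S)) => // /Sk/mem_trees ->.
  rewrite big_filter big_mkcond/=; apply: ler_sum => t _.
  by case: ifP => // _; rewrite exprn_ge0.
move=> SS.
have : (size S)%:R * 4^-1 ^+ k <= 1 :> rat.
  apply: le_trans (_ : 2^-1 <= 1 :> rat) => //; apply: le_trans SS.
  rewrite mulr_natl -(count_predT S) -iter_addr_0 -big_const_seq.
  rewrite big_seq [leRHS]big_seq; apply: ler_sum => t tS.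
  by rewrite ler_wiXn2l ?invr_ge0 ?invf_le1 ?Sk.
by rewrite exprVn ler_pdivrMr ?exprn_gt0// mul1r -natrX ler_nat.
Qed.

Lemma num_clade_shapes_le k t :
  (num_clade_shapes t <= 4 ^ k + big_clades k t)%N.
Proof.
rewrite num_clade_shapesE -(count_predC (fun s => k <= leaves s)%N) addnC leq_add//.
  rewrite -size_filter size_small_trees ?filter_uniq ?undup_uniq// => s.
  by rewrite mem_filter /= -ltnNge => /andP[/ltnW].
exact/leq_count_subseq/undup_subseq.
Qed.

(** * Tail bounds and asymptotics *)

Section asymptotics.
Context {R : realType}.
Local Notation h := (@harmonic_sum R).

Lemma ln_le_harmonic_sum k : ln k.+1%:R <= h k.
Proof.
elim: k => [|k IH]; first by rewrite ln1 harmonic_sum0.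
have k0 : 0 < k.+1%:R :> R by rewrite ltr0n.
rewrite harmonic_sumS (_ : k.+2%:R = k.+1%:R * (1 + k.+1%:R^-1)); last first.
  by rewrite mulrDr mulr1 mulfV ?gt_eqF// natr1.
have : 0 < k.+1%:R^-1 :> R by rewrite invr_gt0.
move: (k.+1%:R^-1) => z z0; rewrite lnM ?posrE//; last by lra.
by rewrite lerD// le_ln1Dx//; lra.
Qed.

Lemma harmonic_sum_le_ln k : (0 < k)%N -> h k <= 1 + ln k%:R.
Proof.
case: k => // k _; elim: k => [|k IH].
  by rewrite harmonic_sumS harmonic_sum0 ln1 invr1 add0r addr0.
rewrite harmonic_sumS; apply: le_trans (lerD IH (lexx _)) _.
have k0 : 0 < k.+1%:R :> R by rewrite ltr0n.
have k2 : 0 < k.+2%:R :> R by rewrite ltr0n.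
have k1 : k.+2%:R^-1 < 1 :> R by rewrite invf_lt1// ltr1n.
rewrite [in ln k.+1%:R](_ : k.+1%:R = k.+2%:R * (1 + - k.+2%:R^-1)); last first.
  by rewrite mulrDr mulr1 mulrN mulfV ?gt_eqF// -[k.+2%:R]natr1 addrK.
move: (k.+2%:R^-1) k1 => z z1; rewrite lnM ?posrE//; last by lra.
have : ln (1 + - z) <= - z by rewrite le_ln1Dx//; lra.
lra.
Qed.

Lemma ln2_bounds : 2^-1 <= ln (2 : R) <= 1.
Proof.
apply/andP; split; last by rewrite [X in ln X](_ : 2 = 1 + 1)// le_ln1Dx//; lra.
rewrite -lerN2 -lnV ?posrE// [X in ln X](_ : 2^-1 = 1 + - 2^-1); last by field.
by rewrite le_ln1Dx//; lra.
Qed.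

Lemma ln_trunc_log n : (0 < n)%N ->
  (trunc_log 2 n)%:R / 2 <= ln (n%:R : R) <= (trunc_log 2 n)%:R + 1.
Proof.
move=> n0; have /andP[l1 l2] := ln2_bounds.
have /andP[L1 L2] := trunc_log_bounds (isT : (1 < 2)%N) n0.
set L := trunc_log 2 n in L1 L2 *.
have lnE m : ln (2 ^ m)%:R = m%:R * ln 2 :> R.
  by rewrite natrX lnXn// mulr_natl.
have p m : ((2 ^ m)%N%:R : R) \is Num.pos by rewrite posrE ltr0n expn_gt0.
have nR : (n%:R : R) \is Num.pos by rewrite posrE ltr0n.
apply/andP; split.
  apply: (@le_trans _ _ (ln (2 ^ L)%:R)); last by rewrite ler_ln// ler_nat.
  by rewrite lnE ler_wpM2l.
apply: (@le_trans _ _ (ln (2 ^ L.+1)%:R)); first by rewrite ler_ln// ler_nat ltnW.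
by rewrite lnE natr1 ler_piMr.
Qed.

(** With L the truncated logarithm, n >= e^(L / 2) >= (L / 2)^4 / 4!, and 384 = 2^4 * 4!. *)
Lemma trunc_log_quartic n : (0 < n)%N -> (trunc_log 2 n)%:R ^+ 4 <= 384 * n%:R :> R.
Proof.
move=> n0; have /andP[lL _] := ln_trunc_log n0.
set L := _%:R in lL *; have L0 : 0 <= L / 2 by rewrite divr_ge0.
have := expR_ge1Dxn 3 L0.
have : expR (L / 2) <= n%:R by rewrite -[leRHS]lnK ?posrE ?ltr0n// ler_expR.
rewrite (_ : 4`!%:R = 24 :> R)// exprMn; lra.
Qed.

(** Chernoff bound: [x] makes the shift twice the exponent that [mgf_big_clades_upper] allows, and h
    K >= 1 simplifies what is left. *)
Lemma mean_upper_tail K n x : (0 < K)%N -> (0 < n)%N -> 12 <= h (4 * K) ->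
  x = 16 * (h K / K%:R * n%:R) ->
  mean n (fun t => expR ((16 * h n)^-1 * ((big_clades (4 * K) t)%:R - x))) <=
  expR (- (n%:R / (2 * K%:R * h n))).
Proof.
move=> K0 n0 hK xE; have hn : 0 < h n by exact: harmonic_sum_gt0.
have kR : 0 < K%:R :> R by rewrite ltr0n.
under eq_fun do rewrite mulrBr addrC expRD.
rewrite meanZ; apply: le_trans (ler_wpM2l (expR_ge0 _)
  (mgf_big_clades_upper K0 hK (_ : 0 < n <= n)%N)) _; first by rewrite n0 leqnn.
rewrite -expRD ler_expR.
have hK1 := harmonic_sum_ge1 (R := R) K0.
have ux : upper_rate (h K / K%:R) n <= h K / K%:R * n%:R.
  rewrite ge_max; apply/andP; split; last by rewrite gerBl ltW.
  by rewrite mulr_ge0// divr_ge0//; lra.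
apply: (@le_trans _ _ (- ((16 * h n)^-1 * x) + (2 * h n)^-1 * (h K / K%:R * n%:R))).
  by rewrite lerD2l ler_wpM2l// invr_ge0 mulr_ge0// ltW.
rewrite -subr_ge0 [X in 0 <= X](_ : _ = (h K - 1) * n%:R / (2 * K%:R * h n)); last first.
  by rewrite xE; field; rewrite !gt_eqF.
by rewrite divr_ge0 ?mulr_ge0 ?(ltW kR) ?(ltW hn) ?subr_ge0.
Qed.

(** As 2 k <= n, the deficit is at most n / 2 and [lower_rate k n] at least n / (8 k); [x] makes the
    shift half of that. *)
Lemma mean_lower_tail k n x : (1 < k)%N -> (2 * k <= n)%N ->
  x = h k.-1 / (128 * k%:R) * n%:R ->
  mean n (fun t => expR (8 / h k.-1 * (x - (big_clades k t)%:R))) <=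
  expR (- (n%:R / (16 * k%:R))).
Proof.
move=> k1 kn xE; have hk : 0 < h k.-1 by apply: harmonic_sum_gt0; lia.
have kR : 0 < k%:R :> R by rewrite ltr0n; lia.
under eq_fun do rewrite mulrBr expRD -mulNr.
rewrite meanZ; apply: le_trans (ler_wpM2l (expR_ge0 _)
  (mgf_big_clades_lower k1 (_ : 0 < n)%N)) _; first by lia.
rewrite -expRD ler_expR /lower_rate.
have dk : deficit k%:R n%:R <= n%:R / 2 :> R.
  apply: (le_trans (deficit_le n%:R kR)).
  by rewrite ler_pdivlMr// mulrC -(natrM _ 2) ler_nat.
apply: (@le_trans _ _ (8 / h k.-1 * x - (n%:R / 2) / (4 * k%:R))).
  rewrite lerD2l lerN2 ler_wpM2r ?invr_ge0 ?mulr_ge0//; lra.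
rewrite le_eqVlt; apply/orP; left; apply/eqP; rewrite xE.
by field; rewrite !gt_eqF.
Qed.

End asymptotics.

Lemma div16_bounds L m : (32 + 16 * m <= L)%N ->
  [/\ 0 < L %/ 16, 16 * (L %/ 16) <= L & m <= 4 * (L %/ 16)]%N.
Proof. by split; lia. Qed.

(** * Choice of the thresholds K and k, and the probability of a bad tree *)

Section whp.
Context {R : realType}.
Local Notation h := (@harmonic_sum R).
Let f (n : nat) : R := n%:R * ln (ln n%:R) / ln n%:R.

Lemma ln_ln_ge1 n : (32 <= trunc_log 2 n)%N -> 1 <= ln (ln n%:R) :> R.
Proof.
move=> L32; have n0 : (0 < n)%N by case: n L32.
have /andP[lL _] := @ln_trunc_log R n n0; have /andP[l2 _] := @ln2_bounds R.
have L16 : 32 <= (trunc_log 2 n)%:R :> R by rewrite ler_nat.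
apply: (@le_trans _ _ (ln (2 ^+ 4))); first by rewrite lnXn//; lra.
by rewrite ler_ln ?posrE ?exprn_gt0//; lra.
Qed.

(** 4^(4K) and K are both at most 2^(8K), so their product is at most 2^(16K) <= n. *)
Lemma small_shapes_le n (K := (trunc_log 2 n %/ 16)%N) : (0 < n)%N -> (0 < K)%N ->
  (4 ^ (4 * K))%N%:R <= h K / K%:R * n%:R :> R.
Proof.
move=> n0 K0; have /andP[L1 _] := trunc_log_bounds (isT : (1 < 2)%N) n0.
have le4 : (4 ^ (4 * K) * K <= n)%N.
  apply: leq_trans L1; apply: (@leq_trans (2 ^ (16 * K))).
    have -> : (4 ^ (4 * K) = 2 ^ (8 * K))%N by rewrite -[(8 * K)%N](mulnA 2 4 K) (expnM 2 2).
    rewrite [X in (_ <= 2 ^ X)%N](_ : _ = 8 * K + 8 * K)%N; last by lia.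
    rewrite expnD leq_mul2l; apply/orP; right.
    apply: leq_trans (ltnW (ltn_expl K (isT : 1 < 2)%N)) _.
    by rewrite leq_exp2l//; lia.
  by rewrite leq_exp2l// /K; lia.
have kR : 0 < K%:R :> R by rewrite ltr0n.
rewrite mulrAC ler_pdivlMr// -natrM.
apply: (@le_trans _ _ n%:R); first by rewrite ler_nat.
by rewrite ler_peMl// harmonic_sum_ge1.
Qed.

(** With l = ln n, K lies between l / 64 and l, so h K <= 1 + ln l <= 2 ln l, and 128 = 2 * 64. *)
Lemma upper_scale_le n (K := (trunc_log 2 n %/ 16)%N) : (32 <= trunc_log 2 n)%N ->
  17 * (h K / K%:R * n%:R) <= 17 * 128 * f n.
Proof.
move=> L32; have n0 : (0 < n)%N by case: n @K L32.
have /andP[lL Ll] := @ln_trunc_log R n n0; have e1 := ln_ln_ge1 L32.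
set L := trunc_log 2 n in K L32 lL Ll *.
have LR : 32 <= L%:R :> R by rewrite ler_nat.
have K0 : (0 < K)%N by rewrite /K; lia.
have K0R : 0 < K%:R :> R by rewrite ltr0n.
have LK : L%:R <= 32 * K%:R :> R by rewrite -(natrM _ 32) ler_nat /K; lia.
have KL : 16 * K%:R <= L%:R :> R by rewrite -(natrM _ 16) ler_nat /K; lia.
rewrite /f; set l := ln n%:R in lL Ll e1 *; have l0 : 0 < l by lra.
have hK : h K <= 2 * ln l.
  apply: le_trans (harmonic_sum_le_ln K0) _.
  have : ln K%:R <= ln l :> R by rewrite ler_ln ?posrE//; lra.
  lra.
have nR : 0 <= n%:R :> R by [].
have : h K / K%:R <= 128 * (ln l / l).
  apply: (@le_trans _ _ (2 * ln l * (64 / l))); last first.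
    rewrite le_eqVlt; apply/orP; left; apply/eqP.
    by field; rewrite gt_eqF.
  rewrite ler_pM ?harmonic_sum_ge0 ?invr_ge0//.
  by rewrite ler_pdivlMr// mulrC ler_pdivrMr//; lra.
move=> /(ler_wpM2r nR).
have -> : n%:R * ln l / l = ln l / l * n%:R by rewrite -mulrA mulrC.
by move=> H; rewrite -[17 * 128 * _]mulrA ler_pM2l// mulrA.
Qed.

(** With l = ln n, k lies between l and 1200 l, so h (k - 1) >= ln k >= ln l. *)
Lemma lower_scale_le n (k := (300 * (trunc_log 2 n).+1)%N) :
  (32 <= trunc_log 2 n)%N ->
  (128 * (12 * 100))^-1 * f n <= h k.-1 / (128 * k%:R) * n%:R.
Proof.
move=> L32; have n0 : (0 < n)%N by case: n @k L32.
have /andP[lL Ll] := @ln_trunc_log R n n0; have e1 := ln_ln_ge1 L32.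
set L := trunc_log 2 n in k L32 lL Ll *.
have LR : 32 <= L%:R :> R by rewrite ler_nat.
have k0 : (0 < k)%N by [].
have kE : k%:R = 300 * (L%:R + 1) :> R by rewrite natrM natr1.
clearbody k; rewrite /f; set l := ln n%:R in lL Ll e1 *; have l0 : 0 < l by lra.
have hk : ln l <= h k.-1.
  apply: le_trans (ln_le_harmonic_sum k.-1); rewrite prednK// ler_ln ?posrE ?ltr0n//.
  by rewrite kE; lra.
rewrite -mulrA mulrCA [leRHS]mulrC ler_wpM2l//.
apply: (@le_trans _ _ (ln l * (128 * (12 * 100 * l))^-1)).
  by rewrite le_eqVlt; apply/orP; left; apply/eqP; field; rewrite gt_eqF.
apply: ler_pM => [| |//|]; [lra|rewrite invr_ge0; lra|].
rewrite lef_pV2 ?posrE ?kE; lra.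
Qed.

(* 17 = 16 + 1, for 16 * h K / K * n clades with at least 4 * K leaves, and
   at most h K / K * n smaller shapes. *)
Definition good_tree n t : bool :=
  ((128 * (12 * 100))^-1 * f n <= (num_clade_shapes_u t)%:R) &&
  ((num_clade_shapes t)%:R <= 17 * 128 * f n).

(* With L = log_2 n, the upper bound uses K = L / 16, so that 4^(4K) <= sqrt n,
   and the lower bound uses k = 300 (L + 1), so that n^2 e^(-k/100) <= e^(-L-1). *)
Lemma mean_bad_tree_le : exists L0, forall n, (L0 <= trunc_log 2 n)%N ->
  mean n (fun t => (~~ good_tree n t)%:R) <= 3 * expR (- (trunc_log 2 n)%:R) :> R.
Proof.
(* [m] ensures h (4 K) >= 12 for [mean_upper_tail]. [T] ensures L >= 2000, from where
   [trunc_log_quartic] makes n exceed 5 L^3 and 10000 L^2. *)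
pose T := Num.bound (20 * 100 : R); pose m := Num.bound (expR 12 : R).
have hT : 20 * 100 <= T%:R :> R by rewrite ltW// archi_boundP// mulr_ge0.
have hm : 12 <= h m.
  apply: le_trans (ln_le_harmonic_sum m).
  rewrite -[leLHS]expRK ler_ln ?posrE ?expR_gt0 ?ltr0n//.
  by rewrite ltW// (lt_trans (archi_boundP (expR_ge0 _)))// ltr_nat.
clearbody m T; exists (32 + T + 16 * m)%N => n Ln.
have n0 : (0 < n)%N by case: n Ln.
have L32 : (32 <= trunc_log 2 n)%N by apply: leq_trans Ln; rewrite -addnA leq_addr.
have [K0 K16 mK] : [/\ 0 < trunc_log 2 n %/ 16,
    16 * (trunc_log 2 n %/ 16) <= trunc_log 2 n & m <= 4 * (trunc_log 2 n %/ 16)]%N.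
  by apply: div16_bounds; apply: leq_trans Ln; rewrite leq_add2r leq_addr.
have /andP[lL Ll] := @ln_trunc_log R n n0.
have L4 := @trunc_log_quartic R n n0.
have small := small_shapes_le n0; have up := upper_scale_le L32.
have low := lower_scale_le L32.
move: L32 lL Ll L4 small up low Ln K0 K16 mK.
set L := trunc_log 2 n; set K := (L %/ 16)%N; set k := (300 * L.+1)%N.
move=> L32 lL Ll L4 small up low Ln K0 K16 mK.
have l2000 : 20 * 100 <= L%:R :> R.
  apply: le_trans hT _; rewrite ler_nat; apply: leq_trans Ln.
  by rewrite -addnA addnCA leq_addr.
have K0R : 0 < K%:R :> R by rewrite ltr0n.
have KL : 16 * K%:R <= L%:R :> R by rewrite -(natrM _ 16) ler_nat.
have h4K : 12 <= h (4 * K) by apply: le_trans hm (le_harmonic_sum mK).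
have kE : k%:R = 300 * (L%:R + 1) :> R by rewrite natrM natr1.
have k1 : (1 < k)%N by rewrite /k mulnS.
have kR : 0 < k%:R :> R by rewrite ltr0n ltnW.
have hn : h n <= L%:R + 2 by have := @harmonic_sum_le_ln R n n0; lra.
have hn0 : 0 < h n by exact: harmonic_sum_gt0.
have nR : 0 < n%:R :> R by rewrite ltr0n.
set l : R := L%:R in l2000 KL kE hn lL Ll L4 *.
have l0 : 0 <= l by [].
have l3 : 5 * l ^+ 3 <= n%:R.
  have : 20 * 100 * l ^+ 3 <= 384 * n%:R.
    by apply: le_trans L4; rewrite [leRHS]exprS; apply: ler_wpM2r => //; exact: exprn_ge0.
  have : 0 <= l ^+ 3 by exact: exprn_ge0.
  lra.
have l2 : 5 * (20 * 100 * l ^+ 2) <= n%:R.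
  apply: le_trans l3; rewrite ler_pM2l// [leRHS]exprS.
  by rewrite ler_wpM2r ?sqr_ge0.
have l1 : l <= l ^+ 2 by rewrite expr2 ler_peMl//; lra.
have kn : (2 * k <= n)%N by rewrite -(ler_nat R) natrM kE; lra.
clearbody k K.
set x1 := 16 * (h K / K%:R * n%:R); set x2 := h k.-1 / (128 * k%:R) * n%:R in low *.
pose F1 t := expR ((16 * h n)^-1 * ((big_clades (4 * K) t)%:R - x1)).
pose F2 t := expR (8 / h k.-1 * (x2 - (big_clades k t)%:R)).
(* Union bound: on a bad tree [F1] is at least 1 (too many large clades), or [F2] is (too few), or
   there are twins. *)
apply: (@le_trans _ _ (mean n (fun t => F1 t + (F2 t + (twins k t)%:R)))).
  apply: ler_mean => // t _.
  have F10 : 0 <= F1 t by exact: expR_ge0.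
  have F20 : 0 <= F2 t by exact: expR_ge0.
  case: (boolP (good_tree n t)) => [_|bad] /=; first by rewrite !addr_ge0.
  have [tw|tw] := posnP (twins k t); last first.
    have : 1 <= (twins k t)%:R :> R by rewrite ler1n.
    lra.
  rewrite tw addr0; move: bad; rewrite /good_tree negb_and -!ltNge => /orP[].
    move=> Klt; have F21 : 1 <= F2 t.
      rewrite -[leLHS]expR0 ler_expR mulr_ge0 ?divr_ge0 ?harmonic_sum_ge0// subr_ge0.
      apply: le_trans low; apply: ltW; apply: le_lt_trans Klt.
      by rewrite ler_nat big_clades_le_shapes.
    lra.
  move=> Kgt; have F11 : 1 <= F1 t.
    rewrite -[leLHS]expR0 ler_expR mulr_ge0 ?invr_ge0 ?mulr_ge0 ?(ltW hn0)//.
    have : (num_clade_shapes t)%:R <= (4 ^ (4 * K))%N%:R + (big_clades (4 * K) t)%:R :> R.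
      by rewrite -natrD ler_nat num_clade_shapes_le.
    have := small K0; rewrite /x1; lra.
  lra.
rewrite !meanD.
rewrite (_ : 3 * _ = expR (- l) + (expR (- l) + expR (- l))); last by ring.
rewrite lerD//; last rewrite lerD//.
- apply: le_trans (mean_upper_tail K0 n0 h4K erefl) _.
  rewrite ler_expR lerN2 ler_pdivlMr ?mulr_gt0//.
  have : K%:R * h n <= l / 16 * (2 * l) by rewrite ler_pM ?(ltW hn0)//; lra.
  have l20 : 0 <= 2 * l by lra.
  move=> /(ler_wpM2l l20).
  have -> : 2 * l * (l / 16 * (2 * l)) = l ^+ 3 / 4 by field.
  have -> : 2 * l * (K%:R * h n) = l * (2 * K%:R * h n) by ring.
  have : 0 <= l ^+ 3 by exact: exprn_ge0.
  lra.
- apply: le_trans (mean_lower_tail k1 kn erefl) _.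
  rewrite ler_expR lerN2 ler_pdivlMr ?mulr_gt0// kE.
  rewrite (_ : l * _ = 16 * (300 * (l ^+ 2 + l))); last by ring.
  lra.
- apply: le_trans (mean_twins_le k n0) _.
  rewrite -{1}[n%:R]lnK ?posrE// -expRM_natl -expRD ler_expR kE; lra.
Qed.

End whp.

Section conclusion.
Context {R : realType}.
Let f (n : nat) : R := n%:R * ln (ln n%:R) / ln n%:R.

Lemma expRN_trunc_log_le n : (0 < n)%N ->
  expR (- (trunc_log 2 n)%:R) <= 2 * expR 1 * harmonic n :> R.
Proof.
move=> n0; have /andP[_ Ll] := @ln_trunc_log R n n0.
have nR : 0 < n%:R :> R by rewrite ltr0n.
apply: (@le_trans _ _ (expR 1 / n%:R)).
  rewrite -[in n%:R](@lnK R n%:R) ?posrE// -expRB ler_expR; lra.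
(* [harmonic n] is 1 / (n + 1); the factor 2 absorbs the shift. *)
rewrite [2 * _]mulrC -mulrA ler_wpM2l ?expR_ge0//= -[leRHS]mulrC.
rewrite ler_pdivlMl ?ltr0n// ler_pdivrMr//.
by rewrite -natrM ler_nat; lia.
Qed.

(** A good tree bounds the unordered count from below and the ordered one from above, so one
    argument serves both. *)
Lemma Theta_whp_between (X : btree -> R) :
  (forall t, (num_clade_shapes_u t)%:R <= X t <= (num_clade_shapes t)%:R) ->
  Theta_whp (fun n => dtcs n : probability btree R) (fun=> X) f.
Proof.
move=> KX; exists (128 * (12 * 100))^-1, (17 * 128); split.
- by rewrite invr_gt0.
- apply: (@lt_trans _ _ 1); last by lra.
  by rewrite invf_lt1//; lra.
have [L0 bad] := @mean_bad_tree_le R.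
(* 6 = 3 * 2, from [mean_bad_tree_le] and [expRN_trunc_log_le]. *)
apply: (@squeeze_cvge _ _ _ _ (fun n => (1 - 6 * expR 1 * harmonic n)%:E) _ (fun=> 1%E)).
- near=> n; apply/andP; split; last exact: probability_le1.
  have n0 : (0 < n)%N by near: n; exists 1%N.
  have Ln : (L0 <= trunc_log 2 n)%N.
    rewrite trunc_log_max//; near: n; by exists (2 ^ L0)%N.
  set A := [set t | _]; rewrite [leRHS](dtcs_mean n A) lee_fin.
  have : mean n (fun=> 1) <= mean n (fun t => (t \in A)%:R + (~~ @good_tree R n t)%:R) :> R.
    apply: ler_mean => // t _.
    case: (boolP (@good_tree R n t)) => [/andP[lo up]|_] /=; last by rewrite lerDr.
    have /andP[K1 K2] := KX t.
    rewrite addr0 mem_set// /A/=.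
    by apply/andP; split; [exact: le_trans lo K1|exact: le_trans K2 up].
  rewrite mean_cst meanD; have := bad n Ln; have := expRN_trunc_log_le n0; lra.
- rewrite -[X in _ --> X%:E](_ : 1 - 6 * expR 1 * 0 = 1); last by rewrite mulr0 subr0.
  apply: cvg_EFin; first by near=> n.
  apply: cvgB; first exact: cvg_cst.
  by apply: cvgM; [exact: cvg_cst|exact: cvg_harmonic].
- exact: cvg_cst.
Unshelve. all: end_near.
Qed.

End conclusion.

Theorem theorem1p3 (R : realType) :
  let f (n : nat) : R := n%:R * ln (ln n%:R) / ln n%:R in
  Theta_whp (fun n => dtcs n : probability btree R)
            (fun n t => (num_clade_shapes t)%:R) f /\
  Theta_whp (fun n => dtcs n : probability btree R)
            (fun n t => (num_clade_shapes_u t)%:R) f.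
Proof.
by split; apply: Theta_whp_between => t; rewrite lexx ?andbT/= ler_nat num_clade_shapes_u_le.
Qed.
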